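(* Let the distribution $\mu_\beta$ satisfy (G1) and (G2). Then its moment matrix $M$ has a completion $\bar M$ such that $\mathrm{rank}(\bar M)\le K$.
   Context: Setting: $J\ge1$ and $L=(L_1,\dots,L_J)$ are positive integers, $|L|=\sum_jL_j$; coordinates of $\mathbb{R}^{|L|}$ are indexed by pairs $(j,l)$, $1\le j\le J$, $1\le l\le L_j$. $\mathbb{S}^L=\{\beta\in\mathbb{R}^{|L|}:\beta_{jl}\ge0,\ \sum_l\beta_{jl}=1\text{ for all }j\}$. $\mu_\beta$ is a Borel probability measure on $\mathbb{R}^{|L|}$ with $\mu_\beta(\mathbb{S}^L)=1$. $\beta$ is a random vector with law $\mu_\beta$, and $X=(X_1,\dots,X_J)$ is a random vector, $X_j\in\{1,\dots,L_j\}$, with $\Pr(X_j=l\mid\beta)=\beta_{jl}$. (G1): conditionally on $\beta$, $X_1,\dots,X_J$ are mutually independent. (G2): there is a $K$-dimensional linear subspace $Q\subseteq\mathbb{R}^{|L|}$ with $\mu_\beta(Q)=1$ such that no proper linear subspace of $Q$ has $\mu_\beta$-measure $1$. Indices: $\mathcal{L}^0=\{\ell\in\mathbb{Z}^J:0\le\ell_j\le L_j\}$, $\mathcal{L}=\{\ell\in\mathcal{L}^0:\ell_j\ge1\text{ for all }j\}$. The vector $\boldsymbol{l}_j\in\mathbb{Z}^J$ has $j$-th component $l$ and other components $0$. For $\ell\in\mathcal{L}^0$, $M_\ell=\int\prod_{j:\ell_j\ne0}\beta_{j\ell_j}\,\mu_\beta(d\beta)$. Moment matrix $M$: an incomplete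 matrix with rows indexed by pairs $(j,l)$ and columns indexed by $\ell\in\mathcal{L}^0\setminus\mathcal{L}$; the entry in row $(j,l)$, column $\ell$ is $M_{\ell+\boldsymbol{l}_j}$ if $\ell_j=0$, and is unspecified if $\ell_j\ne0$. A completion $\bar M$ of $M$ is a real matrix obtained by filling the unspecified entries with arbitrary real numbers. *)

(* Defs.v *)
From HB Require Import structures.
From mathcomp Require Import all_boot all_order all_algebra.
From mathcomp Require Import all_classical all_reals all_analysis.
Set Implicit Arguments.
Unset Strict Implicit.
Unset Printing Implicit Defensive.
Import Order.TTheory GRing.Theory Num.Theory.
Import numFieldNormedType.Exports.
Local Open Scope classical_set_scope.
Local Open Scope ring_scope.

(* Index conventions: j ranges over 'I_J, and l in {1, ..., L_j} is encoded as
   the element l - 1 of 'I_(L j). The pair (j, l) is [Tagged _ l]. *)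
Definition pair_index (J : nat) (L : 'I_J -> nat) : finType :=
  {j : 'I_J & 'I_(L j)}.

Lemma card_coord (J : nat) (L : 'I_J -> nat) :
  #|pair_index L| = (\sum_(j < J) L j)%N.
Proof.
by rewrite card_tagged sumnE big_map big_enum; apply: eq_bigr => j _;
  rewrite card_ord.
Qed.

Notation rvec R L := 'rV[R]_#|pair_index L|.

(* The Borel measurable space on R^|L| (convertible to [rvec R L]). *)
Notation borel_rvec R L := (g_sigma_algebraType (@open (rvec R L))).

Definition component (R : realType) (J : nat) (L : 'I_J -> nat)
    (b : rvec R L) (j : 'I_J) (l : 'I_(L j)) : R :=
  b ord0 (enum_rank (Tagged (fun k => 'I_(L k)) l : pair_index L)).

Definition simplex_product (R : realType) (J : nat) (L : 'I_J -> nat) :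
    set (borel_rvec R L) :=
  [set b | (forall j l, 0 <= component b (j := j) l) /\
           (forall j, \sum_(l < L j) component b (j := j) l = 1)].

(* [g] is a version of b |-> P(E | beta = b), i.e. [g \o beta] is a version of
   the conditional probability P(E | beta). *)
Definition cond_prob (R : realType) d d' (T : measurableType d)
    (S : measurableType d') (P : probability T R) (beta : {mfun T >-> S})
    (E : set T) (g : S -> R) : Prop :=
  [/\ measurable_fun [set: S] g,
      P.-integrable [set: T] (fun w => (g (beta w))%:E) &
      forall B : set S, measurable B ->
        (P (E `&` beta @^-1` B) = \int[P]_(w in beta @^-1` B) (g (beta w))%:E)%E].

(* Mutual conditional independence of the X_j given [beta]. Taking A_j to be
   the whole range of X_j shows that all subfamilies are covered. *)
Definition cond_independent (R : realType) d d' (T : measurableType d)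
    (S : measurableType d') (P : probability T R) (beta : {mfun T >-> S})
    (J : nat) (L : 'I_J -> nat) (X : forall j, T -> 'I_(L j)) : Prop :=
  forall (A : forall j, set 'I_(L j)) (g : 'I_J -> S -> R),
    (forall j, cond_prob P beta (X j @^-1` A j) (g j)) ->
    cond_prob P beta (\bigcap_(j in [set: 'I_J]) (X j @^-1` A j))
      (fun b => \prod_(j < J) g j b).

Definition minimal_support_dim (R : realType) (J : nat) (L : 'I_J -> nat)
    (mu : probability (borel_rvec R L) R) (K : nat) : Prop :=
  exists Q : {vspace rvec R L},
    [/\ \dim Q = K,
        mu [set b | b \in Q] = 1%E &
        forall Q' : {vspace rvec R L}, (Q' <= Q)%VS -> Q' != Q ->
          mu [set b | b \in Q'] <> 1%E].

(* The index set L^0. The component ell_j in {0, ..., L_j} is encoded as itself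
   in 'I_(L j).+1, so [lift ord0 l] is the nonzero value l + 1 attached to
   l : 'I_(L j), and [unlift ord0] is the partial inverse. *)
Definition cell0 (J : nat) (L : 'I_J -> nat) : finType :=
  {dffun forall j : 'I_J, 'I_(L j).+1}.

Definition full_cells (J : nat) (L : 'I_J -> nat) : {set cell0 L} :=
  [set ell : cell0 L | [forall j, ell j != ord0]].

Definition moment (R : realType) (J : nat) (L : 'I_J -> nat)
    (mu : probability (borel_rvec R L) R) (ell : cell0 L) : R :=
  \int[mu]_b \prod_(j < J)
    (if unlift ord0 (ell j) is Some l then component b l else 1).

(* ell + l_j for ell_j = 0: the j-th component becomes l. *)
Definition set_cell (J : nat) (L : 'I_J -> nat) (ell : cell0 L)
    (j : 'I_J) (l : 'I_(L j)) : cell0 L :=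
  [ffun k => dfwith (T := fun i => 'I_(L i).+1) ell j (lift ord0 l) k].

(* [None] marks an unspecified entry. *)
Definition incomplete_matrix (R : Type) (m n : nat) := 'M[option R]_(m, n).

Definition is_completion (R : Type) (m n : nat)
    (M : incomplete_matrix R m n) (Mbar : 'M[R]_(m, n)) : Prop :=
  forall i j a, M i j = Some a -> Mbar i j = a.

Definition moment_matrix (R : realType) (J : nat) (L : 'I_J -> nat)
    (mu : probability (borel_rvec R L) R) :
    incomplete_matrix R #|pair_index L| #|~: full_cells L| :=
  \matrix_(r, c)
    let: existT j l := enum_val r in
    let ell : cell0 L := enum_val c in
    if ell j == ord0 then Some (moment mu (set_cell ell l)) else None.

(* Main.v *)
Require Import Defs.
From HB Require Import structures.
From mathcomp Require Import all_boot all_order all_algebra.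
From mathcomp Require Import all_classical all_reals all_analysis.
From mathcomp Require Import measurable_realfun.
Set Implicit Arguments.
Unset Strict Implicit.
Unset Printing Implicit Defensive.
Import Order.TTheory GRing.Theory Num.Theory.
Import numFieldNormedType.Exports.
Local Open Scope classical_set_scope.
Local Open Scope ring_scope.

(** The completion is the matrix of mixed moments
      Mbar_(r, ell) = \int b_r * f_ell(b) dmu(b),
    where f_ell(b) is the product of the b_(k, ell_k) over the k with
    ell_k <> 0, whether or not ell_j = 0 for the row r = (j, l).
    When ell_j = 0, multiplying f_ell by b_(j, l) inserts exactly the missing
    factor, so the entry is the prescribed moment M_(ell + l_j)
    ([cell_monomial_set_cell]).  When ell_j <> 0, the same formula serves as
    the choice of the free entry.

    For a fixed ell the column of Mbar is the vector integral of f_ell(b) *: b.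
    Since b lies in Q almost surely, every linear functional vanishing on Q
    vanishes on the column, so the column lies in Q ([Rintegral_submx]).  All
    columns lie in a space of dimension K, hence the rank is at most K.

    The analytic work consists in restricting all integrals to the event D on
    which b belongs to both Q and the product of simplices: it has to be
    measurable and of measure one ([measurable_submx],
    [measurable_simplex_product], [probability_setI_full]), and on D the
    integrands are bounded by 1, hence integrable. *)

(** * Measurability in the Borel space of row vectors *)

Lemma measurable_coord (R : realType) (n : nat) (i : 'I_n) :
  measurable_fun [set: g_sigma_algebraType (@open 'rV[R]_n)]
    (fun b : 'rV[R]_n => b ord0 i).
Proof.
apply: (measurability _ (RGenOpens.measurableE R)).
move=> _ [_ [x [y ->]] <-]; rewrite setTI; apply: sub_sigma_algebra.
apply: (open_comp (f := fun b : 'rV[R]_n => b ord0 i)); last first.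
  exact: interval_open.
by move=> b _; exact: coord_continuous.
Qed.

(** A row space is cut out by finitely many linear equations, the columns of
    [cokermx B], each of which is a measurable condition. *)
Lemma measurable_submx (R : realType) (m n : nat) (B : 'M[R]_(m, n)) :
  measurable ([set b | (b <= B)%MS] : set (g_sigma_algebraType (@open 'rV[R]_n))).
Proof.
pose C := cokermx B.
have -> : [set b : 'rV[R]_n | (b <= B)%MS] =
    \bigcap_(k in [set: 'I_n])
      ((fun b : 'rV[R]_n => \sum_i b ord0 i * C i k) @^-1` [set 0]).
  apply/seteqP; split => b /=.
    rewrite submxE => /eqP bC k _ /=.
    by have /rowP/(_ k) := bC; rewrite !mxE.
  move=> bC; rewrite submxE; apply/eqP/rowP => k.
  by rewrite !mxE; exact: bC.
apply: fin_bigcap_measurable => // k _.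
rewrite -[X in measurable X]setTI.
apply: measurable_sum => // i.
apply: measurable_funM => //.
exact: measurable_coord.
Qed.

(** Turns abstract subspaces into row spaces, so that membership becomes the
    vanishing of [v *m cokermx B] and dimension bounds become rank bounds. *)
Lemma vspace_rowspace (F : fieldType) (n : nat) (Q : {vspace 'rV[F]_n}) :
  exists B : 'M[F]_(\dim Q, n), forall v, (v \in Q) = (v <= B)%MS.
Proof.
exists (\matrix_(i < \dim Q) (vbasis Q)`_i) => v; apply/idP/idP.
  move=> /coord_vbasis ->; apply: summx_sub => i _; apply: scalemx_sub.
  by rewrite -(rowK (fun i : 'I__ => (vbasis Q)`_i)) row_sub.
move=> /submxP[D ->]; rewrite mulmx_sum_row; apply: rpred_sum => i _.
by rewrite rowK rpredZ// vbasis_mem// mem_nth// size_tuple.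
Qed.

(** * The product of simplices *)

Lemma measurable_simplex_product (R : realType) (J : nat) (L : 'I_J -> nat) :
  measurable (@simplex_product R J L).
Proof.
have mc j (l : 'I_(L j)) : measurable_fun [set: borel_rvec R L]
    (fun b => component b l) by exact: measurable_coord.
have -> : @simplex_product R J L =
    (\bigcap_(j in [set: 'I_J]) \bigcap_(l in [set: 'I_(L j)])
      ((fun b => component b l) @^-1` `[0, +oo[)) `&`
    (\bigcap_(j in [set: 'I_J])
      ((fun b => \sum_(l < L j) component b l) @^-1` [set 1])).
  apply/seteqP; split => b /= [b0 b1]; split.
  - by move=> j _ l _ /=; rewrite in_itv/= b0.
  - by move=> j _; exact: b1.
  - by move=> j l; have /= := b0 j I l I; rewrite in_itv/= andbT.
  - by move=> j; exact: b1.
apply: measurableI; apply: fin_bigcap_measurable => // j _.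
  apply: fin_bigcap_measurable => // l _.
  by rewrite -[X in measurable X]setTI; apply: mc.
rewrite -[X in measurable X]setTI.
by apply: measurable_sum => // l; exact: mc.
Qed.

Lemma component_itv (R : realType) (J : nat) (L : 'I_J -> nat)
    (b : rvec R L) (j : 'I_J) (l : 'I_(L j)) :
  simplex_product b -> 0 <= component b l <= 1.
Proof.
move=> [b0 b1]; rewrite b0/= -(b1 j) (bigD1 l)//= lerDl.
by apply: sumr_ge0 => k _; exact: b0.
Qed.

(** * Integrals *)

(** A subspace contains the mean of any integrable vector-valued function with
    values in it: integration commutes with the finitely many linear
    functionals that define the subspace. *)
Lemma Rintegral_submx d (T : measurableType d) (R : realType)
    (mu : {measure set T -> \bar R}) (D : set T) (m n : nat)
    (B : 'M[R]_(m, n)) (v : T -> 'rV[R]_n) :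
  measurable D ->
  (forall i, mu.-integrable D (EFin \o (fun x => v x ord0 i))) ->
  (forall x, D x -> (v x <= B)%MS) ->
  ((\row_i \int[mu]_(x in D) v x ord0 i) <= B)%MS.
Proof.
move=> mD iv vB; rewrite submxE; apply/eqP/rowP => k; rewrite !mxE.
have iC i : mu.-integrable D (fun x => (v x ord0 i * cokermx B i k)%:E).
  under eq_fun do rewrite mulrC EFinM.
  by apply: integrableZl => //; exact: iv.
under eq_bigr => i _ do rewrite mxE -RintegralZr//.
apply: EFin_inj; rewrite -sumEFin.
under eq_bigr => i _ do rewrite fineK ?integrable_fin_num//.
rewrite -integral_sum// integral0_eq// => x Dx.
have := vB x Dx; rewrite submxE => /eqP/rowP/(_ k).
by rewrite !mxE sumEFin => ->.
Qed.

Lemma probability_setI_full d (T : measurableType d) (R : realType)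
    (mu : probability T R) (A B : set T) :
  measurable A -> measurable B -> mu A = 1%E -> mu B = 1%E ->
  mu (A `&` B) = 1%E.
Proof.
move=> mA mB muA muB.
have muCB : mu (~` B) = 0%E by rewrite probability_setC// muB subee.
have muAB : mu (A `\` B) = 0%E.
  apply: subset_measure0 muCB; [exact: measurableD|exact: measurableC|].
  exact: subDsetr.
have : mu A = (mu (A `\` B) + mu (A `&` B))%E by exact: measureDI.
by rewrite muA muAB add0e.
Qed.

(** Moments are integrals of monomials over the whole space, where these may be
    unbounded; this moves them to an almost sure event on which they are
    bounded.  The two integrands agree almost everywhere, so only
    measurability enters. *)
Lemma Rintegral_full d (T : measurableType d) (R : realType)
    (mu : probability T R) (D : set T) (f : T -> R) :
  measurable D -> mu D = 1%E -> measurable_fun [set: T] f ->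
  \int[mu]_x f x = \int[mu]_(x in D) f x.
Proof.
move=> mD muD mf; congr fine; rewrite [RHS]integral_mkcond.
have mf' : measurable_fun [set: T] (EFin \o f) by exact/measurable_EFinP.
apply: ae_eq_integral => //.
  by apply/(measurable_restrictT _ mD); exact: measurable_funS mf'.
have muCD : mu (~` D) = 0%E by rewrite probability_setC// muD subee.
exists (~` D); split; [exact: measurableC|exact: muCD|].
move=> x /= nfx Dx; apply: nfx => _.
by rewrite patchE mem_set.
Qed.

(** * Monomials attached to cells *)

Definition cell_monomial (R : realType) (J : nat) (L : 'I_J -> nat)
    (ell : cell0 L) (b : rvec R L) : R :=
  \prod_(j < J) (if unlift ord0 (ell j) is Some l then component b l else 1).

Lemma measurable_cell_monomial (R : realType) (J : nat) (L : 'I_J -> nat)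
    (ell : cell0 L) :
  measurable_fun [set: borel_rvec R L] (@cell_monomial R J L ell).
Proof.
apply: measurable_prod => j _; case: (unlift _ _) => [l|//].
exact: measurable_coord.
Qed.

Lemma cell_monomial_itv (R : realType) (J : nat) (L : 'I_J -> nat)
    (ell : cell0 L) (b : rvec R L) :
  simplex_product b -> 0 <= cell_monomial ell b <= 1.
Proof.
move=> Sb; apply/andP; split.
  apply: prodr_ge0 => j _; case: (unlift _ _) => [l|//].
  by have /andP[] := component_itv l Sb.
apply: prodr_ile1 => j _; case: (unlift _ _) => [l|]; last by rewrite ler01 lexx.
exact: component_itv.
Qed.

(** The factor of [cell_monomial ell] at [j] is the default 1, and passing to
    [set_cell ell l] replaces it by [component b l]. *)
Lemma cell_monomial_set_cell (R : realType) (J : nat) (L : 'I_J -> nat)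
    (ell : cell0 L) (j : 'I_J) (l : 'I_(L j)) (b : rvec R L) :
  ell j = ord0 ->
  cell_monomial (set_cell ell l) b = cell_monomial ell b * component b l.
Proof.
move=> ellj; rewrite /cell_monomial (bigD1 j)//= [in RHS](bigD1 j)//= ellj unlift_none mul1r.
rewrite /set_cell ffunE dfwithin liftK mulrC; congr (_ * _).
by apply: eq_bigr => k kj; rewrite ffunE dfwithout// eq_sym.
Qed.

Theorem theorem7p3 (R : realType) (J : nat) (L : 'I_J -> nat) (K : nat)
  (hJ : (0 < J)%N) (hL : forall j, (0 < L j)%N)
  (mu : probability (borel_rvec R L) R)
  (hS : mu (@simplex_product R J L) = 1%E)
  (d : measure_display) (T : measurableType d) (P : probability T R)
  (beta : {mfun T >-> borel_rvec R L})
  (hbeta : forall B, measurable B -> distribution P beta B = mu B)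
  (X : forall j, T -> 'I_(L j))
  (mX : forall j l, measurable (X j @^-1` [set l]))
  (hX : forall j l, cond_prob P beta (X j @^-1` [set l])
                      (fun b => component b l))
  (G1 : cond_independent P beta X)
  (G2 : minimal_support_dim mu K) :
  exists2 Mbar : 'M[R]_(#|pair_index L|, #|~: full_cells L|),
    is_completion (moment_matrix mu) Mbar & (\rank Mbar <= K)%N.
Proof.
have [Q [dimQ muQ _]] := G2.
have [B QB] := vspace_rowspace Q.
have QE : [set b : borel_rvec R L | b \in Q] = [set b | (b <= B)%MS].
  by apply/seteqP; split => b /=; rewrite QB.
(* Inside D the integrands are bounded, and b is in the row space of B for
   every b instead of almost every b. *)
pose D : set (borel_rvec R L) := [set b | b \in Q] `&` @simplex_product R J L.
have mS := @measurable_simplex_product R J L.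
have mQ : measurable ([set b | b \in Q] : set (borel_rvec R L)).
  by rewrite QE; exact: measurable_submx.
have mD : measurable D by exact: measurableI.
have muD : mu D = 1%E.
  exact: probability_setI_full.
have muDoo : (mu D < +oo)%E by rewrite muD ltry.
pose f (c : 'I_#|~: full_cells L|) (b : rvec R L) :=
  cell_monomial (enum_val c) b.
have ifb c r : mu.-integrable D (EFin \o (fun b : rvec R L => (f c b *: b) ord0 r)).
  apply: measurable_bounded_integrable => //.
  - apply: (measurable_funS measurableT) => //.
    have -> : (fun b : rvec R L => (f c b *: b) ord0 r)
        = (fun b : rvec R L => f c b * b ord0 r) by apply/funext => b; rewrite mxE.
    apply: measurable_funM; first exact: measurable_cell_monomial.
    exact: measurable_coord.
  - exists 1; split => // M M1 b [_ Sb]; apply/ltW/le_lt_trans/M1.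
    have /andP[f0 f1] := cell_monomial_itv (enum_val c) Sb.
    have /andP[b0 b1] : 0 <= b ord0 r <= 1.
      have := component_itv (tagged (enum_val r)) Sb.
      by rewrite /component taggedK enum_valK.
    by rewrite mxE ger0_norm ?mulr_ge0// mulr_ile1.
exists (\matrix_(r, c) \int[mu]_(b in D) (f c b *: b) ord0 r).
  move=> r c a; rewrite !mxE; case rE: (enum_val r) => [j l].
  move=> /=; case: ifP => // /eqP ellj [<-].
  rewrite /moment (@Rintegral_full _ _ _ mu D)//; last first.
    exact: measurable_cell_monomial.
  apply: eq_Rintegral => b _.
  rewrite -/(cell_monomial _ b) cell_monomial_set_cell// mxE.
  by rewrite /component /Tagged -rE enum_valK.
(* Transposing turns the columns of the completion into rows, to be compared
   with the row space of B, which has only \dim Q rows. *)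
rewrite -dimQ -mxrank_tr; apply: leq_trans (rank_leq_row B).
apply: mxrankS; apply/row_subP => c.
have -> : row c (\matrix_(r, c) \int[mu]_(b in D) (f c b *: b) ord0 r)^T =
    \row_r \int[mu]_(b in D) (f c b *: b) ord0 r.
  by apply/rowP => r; rewrite !mxE.
apply: Rintegral_submx => // b [Qb _].
by apply: scalemx_sub; rewrite -QB.
Qed.
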